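(* Let $D$ be a chord diagram with $N$ chords. Put $d=\lambda+2$ and, for an integer $n\ge 0$, let $W_{JJ^{(n)}}(D)$ denote the coefficient of $d^{N-n}$ in $W_J(D)$, regarded as a polynomial in $d$. Then $$W_{JJ^{(n)}}(D)=2^n\sum_{K}(-1)^{a(K)},$$ where the sum is over all $K$ acceptable for the labeled intersection digraph $\mathrm{LID}(D)$ such that $\deg_4(K)=n$.
   Context: **Chord diagrams.** A chord diagram $D$ with $N$ chords consists of $2N$ distinct points on an oriented line, paired into $N$ chords. Each chord has a left and a right end-point. The chords are ordered $1,\dots,N$ from left to right according to their left end-points. Two distinct chords with left/right end-points $a_1<a_2$ and $b_1<b_2$ intersect if $a_1<b_1<a_2<b_2$ or $b_1<a_1<b_2<a_2$; the first is completely contained in the second if $b_1<a_1<a_2<b_2$. **The weight system $W_J$.** $W_J$ is the $0$-framed colored Jones ($\mathfrak{sl}_2$) weight system, normalized to equal $1$ on the diagram with no chords. It is given explicitly as follows, with $\lambda$ an indeterminate. The end-points of the chords of $D$ cut the line into segments $s_0,\dots,s_{2N}$ listed from left to right. Given a map $\sigma:\{\text{chords of }D\}\to\{-1,0,1\}$, define integers $m(s_i)$ by $m(s_0)=0$, $m(s_{i+1})=m(s_i)+\sigma(v)$ if the point between $s_i$ and $s_{i+1}$ is the left end-point of the chord $v$, and $m(s_{i+1})=m(s_i)-\sigma(v)$ if it is the right end-point of $v$. For a chord $v$ let $k$ (resp. $k'$) be the value of $m$ on the segment ending at the left (resp. right) end-point of $v$, and set $$w_\sigma(v)=\begin{cases}(k+1)(\lambda-k'+1)&\sigma(v)=1\\(\lambda-k+1)(k'+1)&\sigma(v)=-1\\\tfrac12\big((\lambda-2k)(\lambda-2k')-\lambda(\lambda+2)\big)&\sigma(v)=0.\end{cases}$$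 Then $W_J(D)=\sum_\sigma\prod_v w_\sigma(v)$. **Labeled intersection digraph.** $\mathrm{LID}(D)$ has as vertices the chords $1,\dots,N$ of $D$. Its arcs are: an uncolored arc $(i,j)$ for each pair $i<j$ of intersecting chords; one loop (uncolored, regarded as leaving its vertex) at each vertex; and a red arc $(i,j)$ for each pair of chords such that $i$ is completely contained in $j$. **Acceptable objects.** Let $G=(V,A)$ be a finite digraph with one loop at each vertex (a loop is considered as an arc leaving its vertex), in which some non-loop arcs are colored red and the remaining arcs are uncolored. Write $(i,j)$ for an arc with initial vertex $i$ and terminal vertex $j$. A collection $K$ of arcs, each with a thickening of one of its two ends, is acceptable for $G$ if: - for a red arc $(i,j)$ of $G$, both the arc $(i,j)$ and its reversal $(j,i)$ may appear in $K$, but always thickened at $i$; for an uncolored arc $(i,j)$ of $G$, the arc $(i,j)$ with either end thickened may appear in $K$, but its reversal may not; - each vertex of $V$ is incident with $0$, $2$ or $4$ thickened arcs of $K$, where a loop contributes $2$ to the degree of its vertex; a loop is always thickened at its initial segment (it counts as one arc thickened at its vertex, leaving the vertex, and its other end counts as a non-thickened incidence); - exactly half of the arcs of $K$ incident with a vertex are thickened at that vertex; - if two arcs are thickened at a vertex, then one of them enters and the other leaves that vertex. $K$ is a set of thickened arcs: the same uncolored non-loop arc thickened at its two different ends gives two different possible elements of $K$ (both may occur), and likewise a red arc $(i,j)$ and its reversal (both thickened at $i$) are two different possible elements of $K$. **Notation.** $\deg_4(K)$ is the number of vertices incident with $4$ arcs of $K$ (loops counted twice); $a(K)$ is the number of arcs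 of $K$ whose initial segment is thickened (orientation in $K$, so for a reversed red arc the reversed orientation is used). *)

(* Defs.v *)
From mathcomp Require Import all_boot all_order all_algebra.

Set Implicit Arguments.
Unset Strict Implicit.
Unset Printing Implicit Defensive.

Import Order.TTheory GRing.Theory Num.Theory.
Local Open Scope ring_scope.

(* The 2N points are 0, ..., 2N-1 from left to right, and the chords are named
   0, ..., N-1 in the order of their left end-points.  The 2N end-points are
   pairwise distinct, hence (by counting) exhaust the 2N points. *)
Record chord_diagram (N : nat) := ChordDiagram {
  lend : 'I_N -> 'I_(2 * N);
  rend : 'I_N -> 'I_(2 * N);
  lend_lt_rend : forall v, (lend v < rend v)%N;
  lend_mono : forall u v : 'I_N, (u < v)%N -> (lend u < lend v)%N;
  rend_inj : injective rend;
  lend_neq_rend : forall u v, lend u != rend v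
}.

Definition intersecting N (D : chord_diagram N) (u v : 'I_N) : bool :=
  (lend D u < lend D v < rend D u)%N && (rend D u < rend D v)%N ||
  (lend D v < lend D u < rend D v)%N && (rend D v < rend D u)%N.

Definition contained N (D : chord_diagram N) (u v : 'I_N) : bool :=
  (lend D v < lend D u)%N && (rend D u < rend D v)%N.

Definition sign : finType := seq_sub [:: -1; 0; 1 : int].

(* [height D sigma i] is m(s_i); the point i lies between s_i and s_(i+1), so
   s_i is the segment ending at the point i.  Each of the two sums has at most
   one term. *)
Fixpoint height N (D : chord_diagram N) (sigma : {ffun 'I_N -> sign})
    (i : nat) : int :=
  if i is p.+1 then
    height D sigma p + \sum_(v | lend D v == p :> nat) val (sigma v)
                     - \sum_(v | rend D v == p :> nat) val (sigma v)
  else 0.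

(* The indeterminate lambda is 'X. *)
Definition chord_weight N (D : chord_diagram N) (sigma : {ffun 'I_N -> sign})
    (v : 'I_N) : {poly rat} :=
  let k : {poly rat} := (height D sigma (lend D v))%:~R in
  let k' : {poly rat} := (height D sigma (rend D v))%:~R in
  if val (sigma v) == 1 then (k + 1) * ('X - k' + 1)
  else if val (sigma v) == -1 then ('X - k + 1) * (k' + 1)
  else (1 / 2 : rat) *: (('X - 2 * k) * ('X - 2 * k') - 'X * ('X + 2)).

Definition W_J N (D : chord_diagram N) : {poly rat} :=
  \sum_(sigma : {ffun 'I_N -> sign}) \prod_v chord_weight D sigma v.

(* Here 'X is d = lambda + 2. *)
Definition W_J_in_d N (D : chord_diagram N) : {poly rat} :=
  W_J D \Po ('X - 2%:P).

(* The coefficient of d^(N-n); it is 0 if the exponent N-n is negative. *)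
Definition W_JJ N (n : nat) (D : chord_diagram N) : rat :=
  if (n <= N)%N then (W_J_in_d D)`_(N - n) else 0.

Record labeled_digraph (V : finType) := LabeledDigraph {
  uncolored : rel V;
  red : rel V;
  uncolored_loop : reflexive uncolored;
  red_nonloop : irreflexive red;
  uncoloredNred : forall x y, uncolored x y -> ~~ red x y
}.

Definition LID_uncolored N (D : chord_diagram N) : rel 'I_N :=
  fun i j => (i == j) || (i < j)%N && intersecting D i j.

Fact LID_uncolored_loop N (D : chord_diagram N) : reflexive (LID_uncolored D).
Proof. by move=> i; rewrite /LID_uncolored eqxx. Qed.

Fact LID_red_nonloop N (D : chord_diagram N) : irreflexive (contained D).
Proof. by move=> i; rewrite /contained ltnn. Qed.

Fact LID_uncoloredNred N (D : chord_diagram N) (i j : 'I_N) :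
  LID_uncolored D i j -> ~~ contained D i j.
Proof.
case/orP => [/eqP <-|/andP[lt_ij _]]; first by rewrite LID_red_nonloop.
by rewrite /contained ltnNge (ltnW (lend_mono D lt_ij)).
Qed.

Definition LID N (D : chord_diagram N) : labeled_digraph 'I_N :=
  LabeledDigraph (LID_uncolored_loop D) (@LID_red_nonloop N D)
    (@LID_uncoloredNred N D).

(* (x, y, b) is an arc from x to y, thickened at x if b and at y if not. *)
Definition thick_arc (V : finType) : finType := (V * V * bool)%type.

Section Acceptable.
Variable V : finType.
Implicit Types (G : labeled_digraph V) (t : thick_arc V) (v : V).
Implicit Types K : {set thick_arc V}.

Definition initial t : V := t.1.1.
Definition terminal t : V := t.1.2.
Definition initial_thick t : bool := t.2.
Definition thick_end t : V := if initial_thick t then initial t else terminal t.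

(* A loop leaves its vertex and does not enter it. *)
Definition is_loop t : bool := initial t == terminal t.
Definition leaves t v : bool := initial t == v.
Definition enters t v : bool := (terminal t == v) && ~~ is_loop t.

(* The last disjunct is the reversal of the red arc from [terminal t] to
   [initial t]. *)
Definition allowed G t : bool :=
  [|| uncolored G (initial t) (terminal t) && (is_loop t ==> initial_thick t),
      red G (initial t) (terminal t) && (thick_end t == initial t)
    | red G (terminal t) (initial t) && (thick_end t == terminal t)].

(* The number of incidences of arcs of K with v; a loop has two. *)
Definition degree K v : nat :=
  (#|[set t in K | initial t == v]| + #|[set t in K | terminal t == v]|)%N.

Definition thick_degree K v : nat := #|[set t in K | thick_end t == v]|.

Definition acceptable G K : bool :=
  [&& [forall t in K, allowed G t],
      [forall v, degree K v \in [:: 0; 2; 4]%N],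
      [forall v, (2 * thick_degree K v)%N == degree K v]
    & [forall v, forall t1 in K, forall t2 in K,
        [&& t1 != t2, thick_end t1 == v & thick_end t2 == v] ==>
        (enters t1 v && leaves t2 v || leaves t1 v && enters t2 v)]].

Definition deg4 K : nat := #|[set v | degree K v == 4%N]|.

Definition a_of K : nat := #|[set t in K | initial_thick t]|.

End Acceptable.

(* Main.v *)
(* Write k_v, k'_v for the heights just before the two ends of a chord v; both
   are linear forms in sigma.  In terms of d, the weight of v is the sum over
   x, y in {0, 1} of phi_xy(sigma(v)) (k_v + 1)^x (k'_v + 1)^y, where phi_xy is a
   finite-difference functional that annihilates s^e for e < x + y.  Expanding
   all affine forms, a monomial prod_v sigma(v)^(e_v) survives only if e_v is at
   least the order of the functional at every v.  The total degree is at most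
   the total order, so equality holds everywhere and no constant term 1 was
   chosen.  What remains is, for each v, an optional term of k_v (an arc entering
   v, thickened at v) and an optional term of k'_v (an arc leaving v, thickened
   at v), each sigma(u) being used as often as terms are chosen at u: this is an
   acceptable set.  On s^(x+y), phi_xy takes the value d, d, -d or -2, the last
   one at the vertices of degree 4. *)

Require Import Defs.
From mathcomp Require Import all_boot all_order all_algebra.
From mathcomp Require Import zify ring.

Set Implicit Arguments.
Unset Strict Implicit.
Unset Printing Implicit Defensive.

Import Order.TTheory GRing.Theory Num.Theory.
Local Open Scope ring_scope.

(** * Sums over signs, options and pairs *)

Lemma sum_sign (R : nmodType) (F : int -> R) :
  \sum_(s : sign) F (val s) = F (-1) + F 0 + F 1.
Proof.
rewrite -(big_map val predT F) (perm_big [:: -1; 0; 1 : int]) /=.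
  by rewrite !big_cons big_nil addr0 addrA.
apply: uniq_perm => //.
  by rewrite map_inj_uniq ?index_enum_uniq //; exact: val_inj.
move=> x; apply/mapP/idP => [[s _ ->]|x_in]; first exact: valP.
by exists (SeqSub x_in); rewrite ?mem_index_enum.
Qed.

Lemma sum_option (R : nmodType) (T : finType) (F : option T -> R) :
  \sum_o F o = F None + \sum_x F (Some x).
Proof.
rewrite (bigD1 None) //=; congr (_ + _).
rewrite (reindex_omap Some id) /=; last by case.
by apply: eq_bigl => x; rewrite eqxx.
Qed.

Lemma sum_ffun_bool (R : nmodType) (T : finType) (F : T -> T -> R) :
  \sum_(f : {ffun bool -> T}) F (f false) (f true) = \sum_x \sum_y F x y.
Proof.
rewrite pair_big /=.
rewrite (reindex (fun p : T * T => [ffun b : bool => if b then p.2 else p.1])) /=.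
  by apply: eq_bigr => p _; rewrite !ffunE.
exists (fun f : {ffun bool -> T} => (f false, f true)) => [[x y] _|f _].
  by rewrite !ffunE.
by apply/ffunP => -[]; rewrite ffunE.
Qed.

Lemma card_set_sum (T : finType) (B : pred T) : #|[set x | B x]| = (\sum_x B x)%N.
Proof. by rewrite -sum1dep_card big_mkcond. Qed.

Lemma big_falsetrue (R : Type) (idx : R) (op : Monoid.com_law idx) (F : bool -> R) :
  \big[op/idx]_b F b = op (F false) (F true).
Proof. by rewrite big_bool Monoid.mulmC. Qed.

(** * Heights as linear forms in the signs *)

Section Heights.
Variables (N : nat) (D : chord_diagram N).

Definition endpoint (v : 'I_N) (b : bool) : nat := if b then rend D v else lend D v.

(** Tells whether [sigma u] occurs in the height just before the end [b] of [v]; for [u = v] this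
    happens only at the right end. *)
Definition covers (v : 'I_N) (b : bool) (u : 'I_N) : bool :=
  (lend D u < endpoint v b <= rend D u)%N.

Lemma heightE (sigma : {ffun 'I_N -> sign}) i :
  height D sigma i = \sum_u (lend D u < i <= rend D u)%N%:R * val (sigma u).
Proof.
elim: i => [|p IHp] /=; first by rewrite big1 // => u _; rewrite mul0r.
rewrite IHp (big_mkcond (fun v => _ == _)).
rewrite (big_mkcond (fun v => rend D v == _ :> nat)).
rewrite -big_split /= -sumrB; apply: eq_bigr => u _.
have lr := lend_lt_rend D u.
(* The step from [p] to [p.+1] is stated without subtraction: a chord opens when its left end is [p]
   and closes when its right end is [p]. *)
have /(congr1 (fun k : nat => k%:R * val (sigma u))) :
    ((lend D u < p.+1 <= rend D u) + (rend D u == p :> nat) =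
     (lend D u < p <= rend D u) + (lend D u == p :> nat))%N.
  by case: ltngtP lr; case: ltngtP; case: ltngtP; lia.
rewrite !natrD !mulrDl => /(canRL (addrK _)) ->.
by rewrite -!mulrb !mulr_natl.
Qed.

End Heights.

(** * Expansion of a single chord weight *)

(* A slot is left unused ([None]), filled with the constant term of an affine
   form ([Some None]) or with one of its variables ([Some (Some u)]). *)
Notation slot V := (option (option V)).

Definition used (V : Type) (f : bool -> slot V) (b : bool) : bool := f b.

(* phi_xy, for x = [p false] and y = [p true]; here 'X is d. *)
Definition stencil (p : bool -> bool) (s : int) : {poly rat} :=
  match p false, p true with
  | false, false => 'X *+ (s == 0)
  | true, false => 'X *+ (s == 1) - 'X *+ (s == 0)
  | false, true => 'X *+ (s == -1) - 'X *+ (s == 0)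
  | true, true => 2 *+ (s == 0) - 1 *+ (s == 1) - 1 *+ (s == -1)
  end.

Section Slots.
Variable V : finType.

Definition slot_ok (A : pred V) (o : slot V) : bool :=
  if o is Some (Some u) then A u else true.

Definition slot_var (sigma : {ffun V -> sign}) (o : slot V) : {poly rat} :=
  if o is Some (Some u) then (val (sigma u))%:~R else 1.

End Slots.

Section ChordWeight.
Variables (N : nat) (D : chord_diagram N).

Lemma chord_weight_in_d (sigma : {ffun 'I_N -> sign}) (v : 'I_N) :
  chord_weight D sigma v \Po ('X - 2%:P) =
  \sum_(f : {ffun bool -> slot 'I_N})
    stencil (used f) (val (sigma v)) *
    \prod_b ((slot_ok (covers D v b) (f b))%:R * slot_var sigma (f b)).
Proof.
pose H b : {poly rat} := (height D sigma (endpoint D v b))%:~R.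
have HE b : \sum_(u : 'I_N) (covers D v b u)%:R * (val (sigma u))%:~R = H b.
  rewrite /H heightE rmorph_sum /=; apply: eq_bigr => u _.
  by rewrite rmorphM /= rmorph_nat.
pose G b (o : slot 'I_N) := (slot_ok (covers D v b) o)%:R * slot_var sigma o.
have GE b : \sum_(o : option 'I_N) G b (Some o) = 1 + H b.
  by rewrite sum_option -HE {1}/G /= mulr1.
pose F (x y : slot 'I_N) :=
  stencil (fun b => if b then isSome y else isSome x) (val (sigma v)) *
  (G false x * G true y).
transitivity (\sum_x \sum_y F x y); last first.
  by rewrite -sum_ffun_bool; apply: eq_bigr => f _; rewrite big_falsetrue.
rewrite sum_option (sum_option (F None)).
under [X in _ = _ + X]eq_bigr do rewrite sum_option.
rewrite big_split /= /F /= -!mulr_sumr.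
under [X in _ = _ + (_ + X)]eq_bigr do rewrite -!mulr_sumr GE.
rewrite -!mulr_sumr -!mulr_suml !GE /G /= !mulr1 !mul1r.
rewrite /chord_weight -/(H false) -/(H true).
have HC b q : H b \Po q = H b by rewrite rmorph_int.
have half (p q : {poly rat}) : p = 2 * q -> (1 / 2 : rat) *: p = q.
  by move=> ->; rewrite -(polyC_natr rat 2) mul_polyC scalerA mul1r mulVf ?scale1r.
case: (sigma v) => s /= sP; rewrite !inE in sP.
pose compE := (comp_polyM, comp_polyB, comp_polyD, comp_polyX, comp_polyZ, comp_polyC).
by case/or3P: sP => /eqP -> /=; rewrite /stencil /= ?(compE, HC);
  [idtac | apply: half | idtac]; rewrite !polyC_natr; ring.
Qed.

End ChordWeight.

(** * Moments of the finite-difference functionals *)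

Definition moment (p : bool -> bool) (e : nat) : {poly rat} :=
  \sum_(s : sign) stencil p (val s) * (val s)%:~R ^+ e.

Lemma momentE (p : bool -> bool) e :
  moment p e = stencil p (-1) * (-1) ^+ e + stencil p 0 * 0 ^+ e + stencil p 1.
Proof.
rewrite /moment (sum_sign (fun s => stencil p s * s%:~R ^+ e)).
by rewrite rmorphN1 rmorph0 rmorph1 expr1n mulr1 addrC addrA.
Qed.

(** A first difference kills constants, a second difference kills affine functions. *)
Lemma moment_small (p : bool -> bool) e : (e < p false + p true)%N -> moment p e = 0.
Proof.
rewrite momentE /stencil; case: (p false) (p true) => [] [] //.
- by case: e => [|[|//]] _; rewrite /= ?expr0 ?expr1 ?expr0n /=; ring.
- by case: e => // _; rewrite /= ?expr0 /=; ring.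
- by case: e => // _; rewrite /= ?expr0 /=; ring.
Qed.

Lemma moment_exact (p : bool -> bool) :
  moment p (p false + p true) =
  (-1) ^+ p true * (if p false && p true then 2 else 'X).
Proof.
rewrite momentE /stencil; case: (p false) (p true) => [] [] /=.
all: by rewrite ?expr0n /= ?expr0 ?expr1 ?expr2; ring.
Qed.

(** * Expansion over all choices of terms *)

Section Assignments.
Variable V : finType.
Implicit Types (A : V -> bool -> pred V) (h : {ffun V -> {ffun bool -> slot V}}).

Definition assigned A h : bool := [forall v, forall b, slot_ok (A v b) (h v b)].

Definition constant_free h : bool := [forall v, forall b, h v b != Some None].

(** The exponent of [sigma u] in the monomial chosen by [h]. *)
Definition hits h (u : V) : nat := \sum_v \sum_b (h v b == Some (Some u)).

(** The order x + y of the functional phi_xy at [v]. *)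
Definition load h (v : V) : nat := (used (h v) false + used (h v) true)%N.

Lemma sum_load h : (\sum_v load h v = \sum_v \sum_b (used (h v) b : nat))%N.
Proof. by apply: eq_bigr => v _; rewrite big_falsetrue. Qed.

Lemma sum_eq_slot (o : slot V) :
  (\sum_u (o == Some (Some u)) = isSome o && (o != Some None))%N.
Proof.
case: o => [[u|]|] /=; try by rewrite big1.
rewrite (eq_bigr (fun w => (u == w) : nat)) // (bigD1 u) //= eqxx big1 // => w.
by rewrite eq_sym => /negPf ->.
Qed.

Lemma sum_hits h :
  (\sum_u hits h u = \sum_v \sum_b (used (h v) b && (h v b != Some None)))%N.
Proof.
rewrite exchange_big; apply: eq_bigr => v _; rewrite exchange_big.
by apply: eq_bigr => b _; rewrite sum_eq_slot.
Qed.

(** Summed over all vertices the inequality is reversed, since a used slot yields one hit, or none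
    if it holds a constant. Both sums agree, and the equality cases of the two [leqif] bounds give
    the two claims. *)
Lemma load_le_hits h :
  (forall v, load h v <= hits h v)%N ->
  constant_free h && [forall v, hits h v == load h v].
Proof.
move=> le_h.
have le_c v b : (used (h v) b && (h v b != Some None) <= used (h v) b
                 ?= iff (h v b != Some None))%N.
  by rewrite /used; case: (h v b) => [[u|]|] /=; split.
have hits_le :=
  leqif_sum (fun v (_ : true) => leqif_sum (fun b (_ : true) => le_c v b)).
rewrite -sum_hits -sum_load in hits_le.
have load_le := leqif_sum (fun v (_ : true) => leqif_eq (le_h v)).
have sum_eq : (\sum_v load h v = \sum_v hits h v)%N.
  by apply/eqP; rewrite eqn_leq load_le hits_le.
have := hits_le.2; have := load_le.2; rewrite sum_eq !eqxx.
move=> /esym/forallP eq_h /esym/forallP free_h.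
apply/andP; split; apply/forallP => v; first exact: free_h.
by rewrite eq_sym; apply: eq_h.
Qed.

Lemma prod_natb (I : finType) (B : pred I) :
  \prod_i (B i)%:R = [forall i, B i]%:R :> {poly rat}.
Proof.
case: forallP => [B_all|/forallP]; first by rewrite big1 // => i _; rewrite B_all.
by rewrite negb_forall => /existsP[i /negPf Bi]; rewrite (bigD1 i) //= Bi mul0r.
Qed.

Lemma slot_varE (sigma : {ffun V -> sign}) (o : slot V) :
  slot_var sigma o = \prod_u (val (sigma u))%:~R ^+ (o == Some (Some u)).
Proof.
case: o => [[u|]|] /=; try by rewrite big1.
rewrite (eq_bigr (fun w => (val (sigma w))%:~R ^+ (u == w))) // (bigD1 u) //= eqxx.
by rewrite big1 ?mulr1 // => w; rewrite eq_sym => /negPf ->.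
Qed.

Lemma prod_slot_var (sigma : {ffun V -> sign}) h :
  \prod_v \prod_b slot_var sigma (h v b) = \prod_u (val (sigma u))%:~R ^+ hits h u.
Proof.
under [RHS]eq_bigr => u _.
  rewrite expr_sum; under eq_bigr => v _ do rewrite expr_sum; over.
rewrite [RHS]exchange_big; apply: eq_bigr => v _; rewrite exchange_big.
by apply: eq_bigr => b _; rewrite slot_varE.
Qed.

(** Distributivity is used twice: first to turn the product over [v] into a sum over [h], then,
    after the exchange of sums, to factor the sum over [sigma] into one moment per vertex. *)
Lemma sum_prod_stencil A :
  \sum_(sigma : {ffun V -> sign}) \prod_v
    \sum_(f : {ffun bool -> slot V}) stencil (used f) (val (sigma v)) *
      \prod_b ((slot_ok (A v b) (f b))%:R * slot_var sigma (f b)) =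
  \sum_(h | assigned A h) \prod_v moment (used (h v)) (hits h v).
Proof.
under eq_bigr do rewrite bigA_distr_bigA.
rewrite exchange_big [RHS]big_mkcond; apply: eq_bigr => h _.
transitivity (\sum_(sigma : {ffun V -> sign}) (assigned A h)%:R *
   \prod_v (stencil (used (h v)) (val (sigma v)) *
            (val (sigma v))%:~R ^+ hits h v)).
  apply: eq_bigr => sigma _; rewrite !big_split /= -prod_slot_var mulrCA; congr (_ * _).
  under eq_bigr do rewrite big_split.
  rewrite big_split /=; congr (_ * _).
  by under eq_bigr do rewrite prod_natb; rewrite prod_natb.
pose Phi v (s : sign) := stencil (used (h v)) (val s) * (val s)%:~R ^+ hits h v.
rewrite -mulr_sumr -(bigA_distr_bigA Phi).
by case: ifP => _; rewrite ?mul1r ?mul0r.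
Qed.

Definition balanced h : bool := constant_free h && [forall v, hits h v == load h v].

Lemma prod_moment h :
  \prod_v moment (used (h v)) (hits h v) =
  if balanced h then
    \prod_v ((-1) ^+ used (h v) true *
             (if used (h v) false && used (h v) true then 2 else 'X))
  else 0.
Proof.
case: ifPn => [/andP[_ /forallP h_bal]|h_unbal].
  by apply: eq_bigr => v _; rewrite (eqP (h_bal v)) moment_exact.
(* An unbalanced [h] has a vertex with fewer hits than its load, and the moment there vanishes. *)
have [/forallP le_h|] := boolP [forall v, load h v <= hits h v]%N.
  by rewrite /balanced load_le_hits in h_unbal.
rewrite negb_forall => /existsP[v]; rewrite -ltnNge => lt_v.
by rewrite (bigD1 v) //= moment_small ?mul0r.
Qed.

Definition leaving h : nat := #|[set v | used (h v) true]|.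

Definition double h : nat := #|[set v | load h v == 2]|.

(** The product is a monomial, with one factor ['X] for each vertex whose load is not 2. *)
Lemma coef_prod_peak h k :
  (\prod_v ((-1) ^+ used (h v) true *
     (if used (h v) false && used (h v) true then 2 else 'X)) : {poly rat})`_k =
  (-1) ^+ leaving h * (2 ^+ double h *+ (k + double h == #|V|)%N).
Proof.
rewrite (eq_bigr (fun v => (-1) ^+ used (h v) true *
    (2 ^+ (load h v == 2) * 'X^(load h v != 2)))); last first.
  move=> v _; rewrite /load; congr (_ * _).
  by case: (used _ false) (used _ true) => [] []; rewrite /= ?mulr1 ?mul1r.
rewrite !big_split /= !prodrXr -!card_set_sum -/(double h) -/(leaving h).
have cardV : (#|[set v | load h v != 2]| + double h = #|V|)%N.
  rewrite addnC -(cardsC [set v | load h v == 2]).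
  by congr (_ + #|pred_of_set _|)%N; apply/setP => v; rewrite !inE.
rewrite -cardV eqn_add2r mulrA.
have -> : (-1) ^+ leaving h * 2 ^+ double h =
          ((-1) ^+ leaving h * 2 ^+ double h)%:P :> {poly rat}.
  by rewrite rmorphM !rmorphXn rmorphN1 /= polyC_natr.
by rewrite coefCM coefXn -mulrA mulr_natr.
Qed.

End Assignments.

(** * Choices of terms as sets of thickened arcs *)

Section ThickArcs.
Variable V : finType.
Implicit Types (G : labeled_digraph V) (K : {set thick_arc V}) (t : thick_arc V).
Implicit Types (h : {ffun V -> {ffun bool -> slot V}}).

(** The arc that encodes the term of [sigma u] in the slot [b] of [v]. *)
Definition arc (v : V) (b : bool) (u : V) : thick_arc V :=
  if b then (v, u, true) else (u, v, false).

Definition thin_end t : V := if initial_thick t then terminal t else initial t.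

Lemma arc_ends t : arc (thick_end t) (initial_thick t) (thin_end t) = t.
Proof. by case: t => [[x y] []]. Qed.

Lemma initial_thick_arc v b u : initial_thick (arc v b u) = b.
Proof. by case: b. Qed.

Lemma thick_end_arc v b u : thick_end (arc v b u) = v.
Proof. by case: b. Qed.

Lemma thin_end_arc v b u : thin_end (arc v b u) = u.
Proof. by case: b. Qed.

Definition arcE := (initial_thick_arc, thick_end_arc, thin_end_arc).

Lemma sum_thick_arc (F : thick_arc V -> nat) :
  (\sum_t F t = \sum_v \sum_b \sum_u F (arc v b u))%N.
Proof.
rewrite pair_big pair_big /=.
rewrite (reindex (fun p : V * bool * V => arc p.1.1 p.1.2 p.2)) //=.
exists (fun t => (thick_end t, initial_thick t, thin_end t)) => [[[v b] u]|t] _ /=.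
  by rewrite !arcE.
exact: arc_ends.
Qed.

Lemma card_arcs K (B : pred (thick_arc V)) :
  #|[set t in K | B t]| =
  (\sum_v \sum_b \sum_u ((arc v b u \in K) && B (arc v b u)))%N.
Proof. by rewrite card_set_sum sum_thick_arc. Qed.

Lemma degree_split K v :
  (degree K v = thick_degree K v + #|[set t in K | thin_end t == v]|)%N.
Proof.
rewrite /degree /thick_degree !card_set_sum -!big_split /=; apply: eq_bigr => t _.
by case: t => [[x y] []]; rewrite /thick_end /thin_end //= addnC.
Qed.

Definition arcs_of h : {set thick_arc V} :=
  [set t | h (thick_end t) (initial_thick t) == Some (Some (thin_end t))].

Lemma mem_arcs_of h v b u : (arc v b u \in arcs_of h) = (h v b == Some (Some u)).
Proof. by rewrite inE !arcE. Qed.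

Definition slots_of K : {ffun V -> {ffun bool -> slot V}} :=
  [ffun v => [ffun b => omap Some [pick u | arc v b u \in K]]].

Lemma arcs_ofK h : (slots_of (arcs_of h) == h) = constant_free h.
Proof.
apply/eqP/forallP => [<- v|h_free].
  by apply/forallP => b; rewrite !ffunE; case: pickP.
apply/ffunP => v; apply/ffunP => b; rewrite !ffunE.
case: pickP => [u|no_u] /=; first by rewrite mem_arcs_of => /eqP.
have {}no_u u : (h v b == Some (Some u)) = false by rewrite -mem_arcs_of no_u.
have /forallP/(_ b) := h_free v.
by case: (h v b) no_u => [[u|]|] // /(_ u); rewrite eqxx.
Qed.

(** The entering-leaving condition leaves [pick] at most one candidate per slot. *)
Lemma slots_ofK G K : acceptable G K -> arcs_of (slots_of K) = K.
Proof.
case/and4P => /forall_inP K_ok _ _ /forallP K_inout.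
apply/setP => t; rewrite -(arc_ends t).
move: (thick_end t) (initial_thick t) (thin_end t) => v b u.
rewrite mem_arcs_of !ffunE; case: pickP => [w Kw|-> //] /=.
apply/eqP/idP => [[<-] //|Ku]; congr (Some (Some _)); apply/eqP; apply: contraT => neq_wu.
have neq_arc : arc v b w != arc v b u.
  by apply: contra neq_wu => /eqP/(congr1 thin_end); rewrite !arcE => ->.
have /forall_inP/(_ _ Kw)/forall_inP/(_ _ Ku)/implyP := K_inout v.
rewrite !arcE neq_arc !eqxx => /(_ isT).
have := K_ok _ Kw; have := K_ok _ Ku.
rewrite /allowed /enters /leaves /is_loop /thick_end.
(* Two arcs leaving [v] cannot do: a loop does not count as entering. Nor can two arcs entering it:
   one would have to be a loop thickened at its terminal end, which is not allowed. *)
case: b {Kw Ku neq_arc} => /=; rewrite /initial /terminal /=.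
  by rewrite (eq_sym w v) (eq_sym u v) !andbN andbF.
rewrite !eqxx !andTb.
case: (altP (u =P v)) => [->|_]; first by rewrite red_nonloop !andbF.
by case: (altP (w =P v)) => [->|_]; rewrite ?red_nonloop ?andbF.
Qed.



Lemma thick_degree_arcs_of h v :
  constant_free h -> thick_degree (arcs_of h) v = load h v.
Proof.
move=> /forallP h_free.
rewrite /thick_degree card_arcs (bigD1 v) //= [X in (_ + X)%N]big1.
  rewrite addn0 /load big_falsetrue.
  have slotE b : (\sum_u ((arc v b u \in arcs_of h) &&
                          (thick_end (arc v b u) == v)))%N = used (h v) b.
    under eq_bigr do rewrite mem_arcs_of arcE eqxx andbT.
    by rewrite sum_eq_slot (forallP (h_free v)) andbT.
  by rewrite !slotE.
move=> w /negPf neq_wv; rewrite big1 // => b _; rewrite big1 // => u _.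
by rewrite arcE neq_wv andbF.
Qed.

Lemma thin_degree_arcs_of h v : #|[set t in arcs_of h | thin_end t == v]| = hits h v.
Proof.
rewrite card_arcs; apply: eq_bigr => w _; apply: eq_bigr => b _.
rewrite (bigD1 v) //= big1 ?addn0 => [|u /negPf neq_uv].
  by rewrite mem_arcs_of arcE eqxx andbT.
by rewrite arcE neq_uv andbF.
Qed.

Lemma a_of_arcs_of h : constant_free h -> a_of (arcs_of h) = leaving h.
Proof.
move=> /forallP h_free; rewrite /a_of card_arcs /leaving card_set_sum.
apply: eq_bigr => v _; rewrite big_falsetrue big1 => [|u _]; last by rewrite arcE andbF.
under eq_bigr do rewrite mem_arcs_of arcE andbT.
by rewrite sum_eq_slot (forallP (h_free v)) andbT.
Qed.

(** A slot holds one arc at most, so distinct arcs thickened at [v] come from its two different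
    slots. *)
Lemma in_out_arcs_of G h v t1 t2 :
  {in arcs_of h, forall t, allowed G t} -> t1 \in arcs_of h -> t2 \in arcs_of h ->
  t1 != t2 -> thick_end t1 = v -> thick_end t2 = v ->
  enters t1 v && leaves t2 v || leaves t1 v && enters t2 v.
Proof.
move=> h_ok; rewrite -(arc_ends t1) -(arc_ends t2).
move: (thick_end t1) (initial_thick t1) (thin_end t1) => v1 b1 u1.
move: (thick_end t2) (initial_thick t2) (thin_end t2) => v2 b2 u2.
move=> h1 h2 + v1E v2E; rewrite !arcE in v1E v2E; subst v1 v2.
have enters_arc u : arc v false u \in arcs_of h -> enters (arc v false u) v.
  move=> /h_ok.
  rewrite /allowed /enters /is_loop /thick_end /initial /terminal /= eqxx.
  by case: (altP (u =P v)) => [->|]; rewrite ?red_nonloop ?andbF.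
have leaves_arc u : leaves (arc v true u) v by exact: eqxx.
case: b1 b2 h1 h2 => [] [] h1 h2.
- by move: h1 h2; rewrite !mem_arcs_of => /eqP -> /eqP[->]; rewrite eqxx.
- by rewrite leaves_arc enters_arc // orbT.
- by rewrite leaves_arc enters_arc.
- by move: h1 h2; rewrite !mem_arcs_of => /eqP -> /eqP[->]; rewrite eqxx.
Qed.

(** Thick incidences count [load] and thin ones [hits], so the half-thickened condition is the
    balance. It makes each degree twice a load, hence 0, 2 or 4. *)
Lemma acceptable_arcs_of G h :
  constant_free h ->
  acceptable G (arcs_of h) =
  assigned (fun v b u => allowed G (arc v b u)) h && [forall v, hits h v == load h v].
Proof.
move=> h_free.
have degE v : degree (arcs_of h) v = (load h v + hits h v)%N.
  by rewrite degree_split thick_degree_arcs_of // thin_degree_arcs_of.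
have okE : [forall t in arcs_of h, allowed G t] =
           assigned (fun v b u => allowed G (arc v b u)) h.
  apply/forall_inP/forallP => [h_ok v|h_ok t]; last first.
    rewrite -(arc_ends t) mem_arcs_of => /eqP ht.
    by have /forallP/(_ (initial_thick t)) := h_ok (thick_end t); rewrite ht.
  apply/forallP => b; case hvb: (h v b) => [[u|]|] //=.
  by apply: h_ok; rewrite mem_arcs_of hvb.
have balE : [forall v, 2 * thick_degree (arcs_of h) v == degree (arcs_of h) v]%N =
            [forall v, hits h v == load h v].
  apply: eq_forallb => v; rewrite degE thick_degree_arcs_of //.
  by rewrite mul2n -addnn eqn_add2l eq_sym.
rewrite /acceptable balE okE.
apply/and4P/andP => [[] //|[h_ok h_bal]]; split=> //.
  apply/forallP => v; rewrite degE (eqP (forallP h_bal v)) /load.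
  by case: (used _ _) (used _ _) => [] [].
apply/forallP => v; apply/forall_inP => t1 h1; apply/forall_inP => t2 h2.
apply/implyP => /and3P[neq_t /eqP v1 /eqP v2]; apply: (@in_out_arcs_of G h) => //.
by apply/forall_inP; rewrite okE.
Qed.

Lemma deg4_arcs_of h : balanced h -> deg4 (arcs_of h) = double h.
Proof.
case/andP=> h_free /forallP h_bal; apply: eq_card => v; rewrite !inE degree_split.
rewrite thick_degree_arcs_of // thin_degree_arcs_of (eqP (h_bal v)).
by rewrite addnn; case: (load h v) => [|[|[|]]].
Qed.

Lemma sum_acceptable G (R : pzRingType) (n : nat) :
  \sum_(K | acceptable G K && (deg4 K == n)) (-1) ^+ a_of K =
  \sum_(h | [&& assigned (fun v b u => allowed G (arc v b u)) h, balanced h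
               & double h == n])
     (-1) ^+ leaving h :> R.
Proof.
rewrite (reindex_onto arcs_of slots_of) /=; last first.
  by move=> K /andP[K_acc _]; exact: slots_ofK K_acc.
apply: eq_big => [h|h /andP[_]]; last by rewrite arcs_ofK => /a_of_arcs_of ->.
rewrite arcs_ofK [LHS]andbC andbA; have [h_free|h_const] := boolP (constant_free h).
  rewrite acceptable_arcs_of // /= /balanced h_free /= -andbA.
  case: (assigned _ _) => //=; case: (boolP [forall v, _]) => //= h_bal.
  by rewrite deg4_arcs_of // /balanced h_free.
by rewrite /balanced (negPf h_const) /= andbF.
Qed.

End ThickArcs.

(** * The intersection digraph and the final count *)

Section IntersectionDigraph.
Variables (N : nat) (D : chord_diagram N).

(** Another chord open at the left end of [v] crosses [v] from the left or contains it; at the right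
    end it crosses from the right or contains it. Crossings are the uncolored arcs, containment
    gives a red arc and its reversal, and [v] open at its own right end is the loop. *)
Lemma allowed_LID (v : 'I_N) (b : bool) (u : 'I_N) :
  allowed (LID D) (arc v b u) = covers D v b u.
Proof.
rewrite /allowed /is_loop /thick_end /covers /=.
have lrv := lend_lt_rend D v; have lru := lend_lt_rend D u.
have [->|neq_vu] := eqVneq v u.
  case: b; rewrite /initial /terminal /= /LID_uncolored /contained eqxx /= ?ltnn //=.
  by rewrite lru leqnn.
have neq_r : rend D v != rend D u by apply: contra neq_vu => /eqP/rend_inj ->.
have /= neq_lv := lend_neq_rend D u v.
have /= neq_lu := lend_neq_rend D v u.
rewrite -!val_eqE /= in neq_vu neq_r neq_lv neq_lu.
have := @lend_mono N D u v; have := @lend_mono N D v u.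
case: b; rewrite /initial /terminal /LID_uncolored /contained /intersecting /=.
all: by rewrite /endpoint -!val_eqE /=; lia.
Qed.

End IntersectionDigraph.

Theorem corollary1p4 (N n : nat) (D : chord_diagram N) :
  W_JJ n D =
  2 ^+ n * \sum_(K : {set thick_arc 'I_N} |
                   acceptable (LID D) K && (deg4 K == n)) (-1) ^+ a_of K.
Proof.
rewrite sum_acceptable.
under eq_bigl => h.
  have -> : assigned (fun v b u => allowed (LID D) (arc v b u)) h =
            assigned (covers D) h.
    apply: eq_forallb => v; apply: eq_forallb => b.
    by case: (h v b) => [[u|]|] //=; exact: allowed_LID.
  over.
have W_sum : W_J_in_d D = \sum_(h | assigned (covers D) h)
    \prod_v moment (used (h v)) (hits h v).
  rewrite -sum_prod_stencil /W_J_in_d /W_J rmorph_sum; apply: eq_bigr => sigma _.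
  by rewrite rmorph_prod; apply: eq_bigr => v _; rewrite /= chord_weight_in_d.
have double_le (h : {ffun 'I_N -> {ffun bool -> slot 'I_N}}) : (double h <= N)%N.
  by rewrite -[leqRHS]card_ord max_card.
(* For [n > N] the default coefficient 0 matches an empty sum, as [double h] is at most [N]. *)
rewrite /W_JJ; case: leqP => [le_nN|lt_Nn]; last first.
  rewrite big_pred0 ?mulr0 // => h; apply/and3P => -[_ _ /eqP hn].
  by have := double_le h; rewrite hn leqNgt lt_Nn.
rewrite W_sum coef_sum mulr_sumr [LHS]big_mkcond [RHS]big_mkcond.
apply: eq_bigr => h _; case: (assigned _ h) => //=; rewrite prod_moment.
case: ifP => /= _; last by rewrite coef0.
(* As [n <= N], writing [N] as [N - n + n] turns the degree condition into [double h == n]. *)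
rewrite coef_prod_peak card_ord -[X in _ == X](subnK le_nN) eqn_add2l.
by case: eqP => [->|_]; rewrite ?mulr1n ?mulr0n ?mulr0 // mulrC.
Qed.
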